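(* Let $d\ge 4$ and $D\ge 4$ be integers and let $\Gamma$ be a $(d,D,-2)$-graph. Then the girth of $\Gamma$ is $2D$.
   Context: All graphs are simple. For integers $\Delta\ge 2$, $D\ge 1$, the Moore bound is $M(\Delta,D)=1+\Delta\left(1+(\Delta-1)+\dots+(\Delta-1)^{D-1}\right)$. For $\epsilon\ge 0$, a $(\Delta,D,-\epsilon)$-graph is a graph of maximum degree $\Delta$, diameter $D$, and order exactly $M(\Delta,D)-\epsilon$. The girth of a graph is the length of its shortest cycle. *)

(* Defs.v *)
From mathcomp Require Import all_boot.

Set Implicit Arguments.
Unset Strict Implicit.
Unset Printing Implicit Defensive.

Record sgraph := SGraph {
  vertex :> finType;
  adj : rel vertex;
  adj_sym : symmetric adj;
  adj_irrefl : irreflexive adj }.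

Definition degree (G : sgraph) (x : G) : nat := #|[set y | adj x y]|.

Definition max_degree (G : sgraph) : nat := \max_(x : G) degree x.

Definition walk (G : sgraph) (x y : G) (n : nat) : Prop :=
  exists p : seq G, [/\ path (@adj G) x p, last x p = y & size p = n].

(* Distance, diameter and girth are given as relations because they may be
   infinite: no natural number is related to two vertices in different
   components, to a disconnected graph, or to an acyclic graph, respectively. *)
Definition distance_is (G : sgraph) (x y : G) (n : nat) : Prop :=
  walk x y n /\ forall m, walk x y m -> n <= m.

Definition diameter_is (G : sgraph) (D : nat) : Prop :=
  (forall x y : G, exists2 n, distance_is x y n & n <= D) /\
  (exists x y : G, distance_is x y D).

(* [ucycle] also accepts sequences of at most two vertices (in particular an
   edge traversed back and forth), which are not cycles of a simple graph. *)
Definition graph_cycle (G : sgraph) (c : seq G) : Prop :=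
  ucycle (@adj G) c /\ 2 < size c.

Definition girth_is (G : sgraph) (g : nat) : Prop :=
  (exists2 c : seq G, graph_cycle c & size c = g) /\
  (forall c : seq G, graph_cycle c -> g <= size c).

Definition moore_bound (Delta D : nat) : nat :=
  1 + Delta * \sum_(i < D) (Delta - 1) ^ i.

(* The order condition is written additively because subtraction on [nat]
   is truncated. *)
Definition defect_graph (Delta D eps : nat) (G : sgraph) : Prop :=
  [/\ max_degree G = Delta, diameter_is G D
    & #|G| + eps = moore_bound Delta D].

(* Main.v *)
(* Call y a repeat of x when there are two distinct non-backtracking walks of
   length at most D from x to y. A graph of defect 2 with d, D >= 4 is regular, so
   counting non-backtracking walks from x shows that x has exactly two repeats,
   with multiplicity. The matrices counting non-backtracking walks of given length
   are polynomials in the adjacency matrix, so the repeat matrix commutes with it: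
   a walk starting at x lifts to a walk from any given repeat of x, through repeats
   of the successive vertices. Two distinct non-backtracking walks of length < D
   with the same ends would give three repeats, so the girth is at least 2D - 1.

   Suppose c_0, ..., c_(2D-2) is a cycle. The repeats of c_i are c_(i+D-1) and
   c_(i+D), reached only along the cycle; hence no other closed non-backtracking
   walk of length at most 2D passes through c_i. Let g be a neighbour of c_0 off the
   cycle. Lifting gives repeats mu, nu of g adjacent to c_(D-1), c_D, and a repeat
   xi of mu adjacent to c_(2D-2). The two walks from g to mu form a cycle
   z_0 = g, z_1, ..., z_D = mu, ..., z_(2D-1), so z_2 has the repeat z_(D+2). Lifting
   z_0 z_1 z_2 from nu and z_D ... z_2 from xi gives two further repeats of z_2,
   different from z_(D+2), hence equal. Then nu and xi are joined by a walk of
   length D off the cycle, which closes up along c_D ... c_(2D-2) to length 2D,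
   a contradiction. *)

Require Import Defs.
From mathcomp Require Import all_boot zify.

Set Implicit Arguments.
Unset Strict Implicit.
Unset Printing Implicit Defensive.

(** * Non-backtracking walks *)

Section Nonbacktracking.

Variable T : eqType.
Implicit Types (l : seq T).

Fixpoint nobt l : bool :=
  if l is a :: l' then
    (if l' is _ :: c :: _ then a != c else true) && nobt l'
  else true.

(** The two pieces overlap in two entries, so any three consecutive entries lie within one of
    them. *)
Lemma nobt_cat (a b : T) l1 l2 :
  nobt (l1 ++ a :: b :: l2) = nobt (l1 ++ [:: a; b]) && nobt (a :: b :: l2).
Proof.
elim: l1 => [|x l1 IH] //.
rewrite !cat_cons; case: l1 IH => [|y [|z l]] IH.
- by rewrite /= andbT.
- by move: IH => /= ->; rewrite andbA.
- by move: IH => /= ->; rewrite !andbA.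
Qed.

Lemma nobt_rev l : nobt (rev l) = nobt l.
Proof.
elim: l => [|a [|b [|c l]] IH] //.
have -> : rev [:: a, b, c & l] = rev l ++ [:: c, b & [:: a]].
  by rewrite !rev_cons -!cats1 -!catA.
have E : rev l ++ [:: c; b] = rev [:: b, c & l].
  by rewrite !rev_cons -!cats1 -!catA.
rewrite nobt_cat E IH /= !andbT andbC; congr (_ && _).
by rewrite eq_sym.
Qed.

Lemma nobt_catl l1 l2 : nobt (l1 ++ l2) -> nobt l1.
Proof.
elim: l1 => [|a l1 IH] //; rewrite cat_cons => /andP[ha hl].
move: ha (IH hl); case: l1 {IH hl} => [|b [|c l]] //=.
by move=> -> ->.
Qed.

Lemma nobt_catr l1 l2 : nobt (l1 ++ l2) -> nobt l2.
Proof. by elim: l1 => [|a l1 IH] //= /andP[_ /IH]. Qed.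

Lemma uniq_nobt l : uniq l -> nobt l.
Proof.
elim: l => [|a l IH] //= /andP[ha hl]; rewrite (IH hl) andbT.
case: l ha {IH hl} => [|b [|c l]] //; rewrite !inE !negb_or.
by case/and3P.
Qed.

Lemma nobt_map_iota (f : nat -> T) a n :
  (forall i, f i != f i.+2) -> nobt [seq f i | i <- iota a n].
Proof.
move=> hf; elim: n a => [|n IH] a //=; rewrite IH andbT.
by case: n {IH} => [|[|n]] /=.
Qed.

End Nonbacktracking.

Lemma path_map_iota (T : Type) (e : rel T) (f : nat -> T) a n :
  (forall i, e (f i) (f i.+1)) -> path e (f a) [seq f i | i <- iota a.+1 n].
Proof. by move=> hf; elim: n a => [|n IH] a //=; rewrite hf IH. Qed.

Lemma last_map_iota (T : Type) (f : nat -> T) a n :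
  last (f a) [seq f i | i <- iota a.+1 n] = f (a + n).
Proof. by elim: n a => [|n IH] a /=; rewrite ?addn0 // IH addSnnS. Qed.

(** * Walks in a graph: gluing, extraction of cycles, enumeration *)

Section Walks.

Variable G : sgraph.
Implicit Types (x y z p : G) (s : seq G).

Definition nbwalk x s y := [&& path (@adj G) x s, nobt (x :: s) & last x s == y].

Lemma path_rev_adj x s :
  path (@adj G) (last x s) (rev (belast x s)) = path (@adj G) x s.
Proof. by rewrite rev_path; apply: eq_path => a b; rewrite adj_sym. Qed.

Lemma nbwalk_rev x s y : nbwalk x s y -> nbwalk y (rev (belast x s)) x.
Proof.
case/and3P=> hp hn /eqP <-; apply/and3P; split.
- by rewrite path_rev_adj.
- by rewrite -rev_rcons -lastI nobt_rev.
- case: s {hp hn} => [|z s] //=.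
  by rewrite rev_cons last_rcons.
Qed.

(** Both walks are seen from their common origin [x], the only place where a new turn arises. The
    head of an empty walk defaults to [x]. *)
Lemma nbwalk_glue x s1 y1 s2 y2 : nbwalk x s1 y1 -> nbwalk x s2 y2 ->
  head x s1 != head x s2 -> nbwalk y1 (rev (belast x s1) ++ s2) y2.
Proof.
move=> h1 h2 hd; have := nbwalk_rev h1.
case/and3P: h1 => p1 n1 /eqP l1; case/and3P: h2 => p2 n2 /eqP l2.
case/and3P=> p1' n1' /eqP l1'; apply/and3P; split.
- by rewrite cat_path p1' l1'.
- have -> : y1 :: rev (belast x s1) ++ s2 = rev (x :: s1) ++ s2.
    by rewrite [x :: s1]lastI rev_rcons l1.
  case: s1 {p1 l1 p1' n1' l1'} n1 hd => [|a s1] n1 hd; first exact: n2.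
  case: s2 {p2 l2} n2 hd => [|b s2] n2 /= hd; first by rewrite cats0 nobt_rev.
  have -> : rev [:: x, a & s1] ++ b :: s2 = rev s1 ++ [:: a, x & b :: s2].
    by rewrite !rev_cons -!cats1 -!catA.
  rewrite nobt_cat; apply/andP; split; last by rewrite /= hd; exact: n2.
  have -> : rev s1 ++ [:: a; x] = rev [:: x, a & s1].
    by rewrite !rev_cons -!cats1 -!catA.
  by rewrite nobt_rev.
- by rewrite last_cat l1' l2.
Qed.

(** For non-empty [s], [last x (belast x s)] is the penultimate vertex of the walk; turning
    conditions at the far end are stated in this form. *)
Lemma head_rev_belast x s y : last x s = y ->
  head y (rev (belast x s)) = last x (belast x s).
Proof.
by case: s => [|a s] //= _; rewrite lastI rev_rcons.
Qed.

Lemma rev_belastK x s y : last x s = y ->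
  rev (belast y (rev (belast x s))) = s.
Proof.
move=> <-; have : rev (last x s :: rev (belast x s)) = x :: s.
  by rewrite -rev_rcons -lastI revK.
by rewrite lastI rev_rcons => -[].
Qed.

Lemma nbwalk_rcons x s y z : nbwalk x s y -> adj y z ->
  last x (belast x s) != z -> nbwalk x (rcons s z) z.
Proof.
move=> h yz hd; have hz : nbwalk y [:: z] z by rewrite /nbwalk /= yz eqxx.
have l : last x s = y by case/and3P: h => _ _ /eqP.
have := nbwalk_glue (nbwalk_rev h) hz; rewrite head_rev_belast // => /(_ hd).
by rewrite rev_belastK // cats1.
Qed.

Lemma nbwalk_split x s1 s2 y : nbwalk x (s1 ++ s2) y ->
  nbwalk x s1 (last x s1) /\ nbwalk (last x s1) s2 y.
Proof.
case/and3P; rewrite cat_path last_cat => /andP[p1 p2] n /eqP l.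
split; apply/and3P; split=> //; try exact/eqP.
  by move: n; rewrite -cat_cons => /nobt_catl.
by move: n; rewrite -cat_cons lastI cat_rcons => /nobt_catr.
Qed.

Lemma nobt_turn x s1 s2 : s1 != [::] -> s2 != [::] -> nobt (x :: s1 ++ s2) ->
  last x (belast x s1) != head x s2.
Proof.
case: s2 => // b s2; case/lastP: s1 => // s1 a _ _; rewrite belast_rcons.
rewrite cat_rcons -cat_cons lastI cat_rcons => /nobt_catr /=.
by case/andP; rewrite last_rcons.
Qed.

(** The first vertex [z] to be visited twice closes a cycle: the stretch between its two visits has
    no other repetition. *)
Lemma nbwalk_cycle x s y : nbwalk x s y -> ~~ uniq (x :: s) ->
  exists2 c : seq G, graph_cycle c & size c <= size s.
Proof.
elim/last_ind: s y => [|s z IH] y //; rewrite -cats1 => w.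
have [w1 _] := nbwalk_split w.
case us: (uniq (x :: s)); last first.
  move=> _; have [|c hc cs] := IH _ w1; first by rewrite us.
  by exists c => //; rewrite size_cat (leq_trans cs) ?leq_addr.
rewrite -cat_cons cats1 rcons_uniq us andbT negbK => zs.
case/and3P: w => pw nw _.
have {pw} : sorted (@adj G) ((x :: s) ++ [:: z]) by [].
move: nw; rewrite -cat_cons.
have -> : size (s ++ [:: z]) = size (x :: s) by rewrite size_cat addn1.
case/splitPr: zs us => l1 l2 us; rewrite -catA => /nobt_catr nw /cat_sorted2[_ pw].
exists (z :: l2); last by rewrite size_cat leq_addl.
move: us; rewrite cat_uniq => /and3P[_ _ ul].
split; first by rewrite /ucycle ul andbT /= -cats1; exact: pw.
(* Length one would be a loop, length two a backtracking step. *)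
case: l2 nw pw {ul} => [|a [|b l2]] //=; first by rewrite adj_irrefl.
by rewrite eqxx.
Qed.

(* The walks of length [k] from [x] whose first step is not to [p]; with [p = x]
   this is no restriction, since [x] is not adjacent to itself. *)
Fixpoint nbwalks k p x : seq (seq G) :=
  if k is k'.+1 then
    [seq z :: s | z <- enum [pred z | adj x z && (z != p)], s <- nbwalks k' x z]
  else [:: [::]].

Lemma mem_nbwalks k p x s :
  (s \in nbwalks k p x) = [&& size s == k, path (@adj G) x s & nobt (p :: x :: s)].
Proof.
elim: k p x s => [|k IH] p x s; first by case: s.
apply/allpairsPdep/and3P => [[z [t [hz ht ->]]]|].
  rewrite mem_enum inE in hz; rewrite IH in ht.
  case/andP: hz => xz zp; case/and3P: ht => st pt nt.
  by rewrite /= eqSS xz pt st (eq_sym p) zp.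
case: s => [[]|z s /= [ss /andP[xz ps] /andP[pz hn]]] //.
exists z, s; split=> //; first by rewrite mem_enum inE xz eq_sym.
by rewrite IH -eqSS ss ps.
Qed.

Lemma uniq_nbwalks k p x : uniq (nbwalks k p x).
Proof.
elim: k p x => [|k IH] p x //=.
apply: allpairs_uniq_dep => //; first exact: enum_uniq.
by move=> [a s] [b t] _ _ /= [-> ->].
Qed.

Definition nbcount k p x y := count (fun s => last x s == y) (nbwalks k p x).

Lemma nbcountS k p x y :
  nbcount k.+1 p x y = \sum_(z | adj x z && (z != p)) nbcount k x z y.
Proof.
rewrite /nbcount /= count_flatten sumnE -map_comp big_map.
rewrite big_enum /=; apply: eq_big => z; rewrite ?inE // => _.
by rewrite count_map; apply: eq_count.
Qed.

Lemma size_nbwalksS k p x :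
  size (nbwalks k.+1 p x) = \sum_(z | adj x z && (z != p)) size (nbwalks k x z).
Proof.
rewrite /= size_allpairs_dep sumnE big_map big_enum /=.
by apply: eq_bigl => z; rewrite inE.
Qed.

End Walks.

(** * Counting non-backtracking walks *)

Section Counting.

Variable G : sgraph.
Implicit Types (x y z p : G) (s : seq G).

Lemma card_forward p x : adj x p -> #|[pred z | adj x z && (z != p)]| = degree x - 1.
Proof.
move=> xp; rewrite /degree (cardsD1 p) inE xp addKn.
by apply: eq_card => z; rewrite !inE andbC.
Qed.

Lemma card_forward_self x : #|[pred z | adj x z && (z != x)]| = degree x.
Proof.
apply: eq_card => z; rewrite !inE.
by case: eqP => [->|]; rewrite ?adj_irrefl ?andbT.
Qed.

Lemma size_nbwalks_le d k p x : (forall x, degree x <= d) ->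
  adj x p -> size (nbwalks k p x) <= (d - 1) ^ k.
Proof.
move=> hd; elim: k p x => [|k IH] p x xp //.
rewrite size_nbwalksS expnS.
apply: (@leq_trans (\sum_(z | adj x z && (z != p)) (d - 1) ^ k)).
  by apply: leq_sum => z /andP[xz _]; apply: IH; rewrite adj_sym.
by rewrite sum_nat_const leq_mul2r (card_forward xp) leq_sub2r ?orbT.
Qed.

Lemma size_nbwalks_reg d k p x : (forall x, degree x = d) ->
  adj x p -> size (nbwalks k p x) = (d - 1) ^ k.
Proof.
move=> hd; elim: k p x => [|k IH] p x xp //.
rewrite size_nbwalksS expnS -{1}(hd x) -(card_forward xp) -sum_nat_const.
by apply: eq_bigr => z /andP[xz _]; apply: IH; rewrite adj_sym.
Qed.

(** * Walks of bounded length *)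

Fixpoint nbshort n x : seq (seq G) :=
  if n is n'.+1 then nbwalks n x x ++ nbshort n' x else nbwalks 0 x x.

Lemma mem_nbshort n x s :
  (s \in nbshort n x) = [&& size s <= n, path (@adj G) x s & nobt (x :: s)].
Proof.
have E k : (s \in nbwalks k x x) = [&& size s == k, path (@adj G) x s & nobt (x :: s)].
  rewrite mem_nbwalks; case: s => [|z s] //=.
  case xz: (adj x z) => //=; suff -> : x != z by [].
  by apply: contraTneq xz => <-; rewrite adj_irrefl.
elim: n => [|n IH]; first by rewrite -[nbshort 0 x]/(nbwalks 0 x x) E leqn0.
by rewrite -[nbshort _ _]/(nbwalks n.+1 x x ++ _) mem_cat E IH -andb_orl -leq_eqVlt.
Qed.

Lemma uniq_nbshort n x : uniq (nbshort n x).
Proof.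
elim: n => [|n IH] //.
rewrite -[nbshort _ _]/(nbwalks n.+1 x x ++ _) cat_uniq uniq_nbwalks IH andbT /=.
apply/hasPn => s; rewrite mem_nbshort => /andP[hs _].
rewrite -[X in ~~ X]/(s \in nbwalks n.+1 x x) mem_nbwalks.
by rewrite ltn_eqF.
Qed.

Lemma size_nbshort_le d n x : (forall x, degree x <= d) ->
  size (nbshort n x) <= 1 + degree x * \sum_(i < n) (d - 1) ^ i.
Proof.
move=> hd; elim: n => [|n IH]; first by rewrite big_ord0 muln0.
rewrite -[nbshort _ _]/(nbwalks n.+1 x x ++ _) size_cat big_ord_recr /= mulnDr addnA addnC.
apply: leq_add => //; rewrite size_nbwalksS -(card_forward_self x) -sum_nat_const.
by apply: leq_sum => z /andP[xz _]; apply: size_nbwalks_le => //; rewrite adj_sym.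
Qed.

Lemma size_nbshort_reg d n x : (forall x, degree x = d) ->
  size (nbshort n x) = 1 + d * \sum_(i < n) (d - 1) ^ i.
Proof.
move=> hd; elim: n => [|n IH]; first by rewrite big_ord0 muln0.
rewrite -[nbshort _ _]/(nbwalks n.+1 x x ++ _) size_cat big_ord_recr /= mulnDr addnA addnC.
congr (_ + _) => //; rewrite size_nbwalksS -{1}(hd x) -(card_forward_self x) -sum_nat_const.
by apply: eq_bigr => z /andP[xz _]; apply: size_nbwalks_reg => //; rewrite adj_sym.
Qed.

Definition shortcount n x y := count (fun s => last x s == y) (nbshort n x).

Lemma sum_shortcount n x : \sum_y shortcount n x y = size (nbshort n x).
Proof.
rewrite /shortcount; elim: (nbshort n x) => [|s l IH] /=; first by rewrite big1.
rewrite big_split /= IH (bigD1 (last x s)) //= eqxx big1 // => z /negPf.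
by rewrite eq_sym => ->.
Qed.

Lemma shortcount_ge n x y (L : seq (seq G)) : uniq L ->
  {in L, forall s, nbwalk x s y && (size s <= n)} -> size L <= shortcount n x y.
Proof.
move=> uL hL; rewrite /shortcount -size_filter; apply: uniq_leq_size => // s /hL.
by rewrite mem_filter mem_nbshort /nbwalk => /andP[/and3P[-> -> ->] ->].
Qed.

Lemma shortcount_gt1 n x y : 1 < shortcount n x y -> exists s1 s2,
  [/\ s1 != s2, nbwalk x s1 y, nbwalk x s2 y, size s1 <= n & size s2 <= n].
Proof.
rewrite /shortcount -size_filter; set L := filter _ _ => hL.
have uL : uniq L by rewrite filter_uniq ?uniq_nbshort.
have hm s : s \in L -> nbwalk x s y /\ size s <= n.
  rewrite mem_filter mem_nbshort => /andP[h1 /and3P[h2 h3 h4]].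
  by rewrite /nbwalk h1 h3 h4.
case: L hL uL hm => [|s1 [|s2 L]] //= _ /andP[h1 _] hm.
have [a1 b1] := hm s1 (mem_head _ _).
have [|a2 b2] := hm s2; first by rewrite !inE eqxx orbT.
by exists s1, s2; split=> //; apply: contraNneq h1 => ->; rewrite mem_head.
Qed.

Lemma shortcountE n x y : shortcount n x y = \sum_(k < n.+1) nbcount k x x y.
Proof.
elim: n => [|n IH]; first by rewrite big_ord1.
rewrite big_ord_recr /= -IH /shortcount /nbcount.
by rewrite -[nbshort n.+1 x]/(nbwalks n.+1 x x ++ _) count_cat addnC.
Qed.

(** * Walk counts as matrices commuting with the adjacency matrix *)

Variable d : nat.
Hypothesis reg : forall x, degree x = d.

(** With [A] the adjacency matrix, [lsum f] and [rsum f] are the products [A f] and [f A]. *)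
Definition lsum (f : G -> G -> nat) x y := \sum_(z | adj x z) f z y.
Definition rsum (f : G -> G -> nat) x y := \sum_(z | adj y z) f x z.
Definition symcomm (f : G -> G -> nat) :=
  (forall x y, f x y = f y x) /\ (forall x y, lsum f x y = rsum f x y).

(* [A * N_(k+1) = N_(k+2) + (d - 1) N_k], with [d] in place of [d - 1] for [k = 0]:
   prepending an edge to a walk either extends it or is undone by its first step. *)
Lemma lsum_nbcount k x y :
  lsum (fun z => nbcount k.+1 z z) x y =
  nbcount k.+2 x x y + (if k is 0 then d else d - 1) * nbcount k x x y.
Proof.
have self (F : G -> nat) u : \sum_(z | adj u z && (z != u)) F z = \sum_(z | adj u z) F z.
  apply: eq_bigl => z; case: (z =P u) => [->|]; last by rewrite andbT.
  by rewrite adj_irrefl.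
have -> : lsum (fun z => nbcount k.+1 z z) x y =
    \sum_(z | adj x z) (nbcount k.+1 x z y + nbcount k z x y).
  apply: eq_bigr => z xz; rewrite nbcountS self nbcountS addnC.
  by rewrite (bigD1 x) /=; last by rewrite adj_sym.
rewrite big_split /= nbcountS self; congr (_ + _).
case: k => [|k].
  by rewrite -(reg x) -(card_forward_self x) -sum_nat_const; symmetry; apply: self.
rewrite nbcountS self big_distrr /=.
under eq_bigr => z xz do rewrite nbcountS.
rewrite (exchange_big_dep (fun z => adj x z)) /=; last by move=> i j _ /andP[].
apply: eq_bigr => u xu; rewrite -(reg x) -(card_forward xu) -sum_nat_const.
by apply: eq_bigl => z; rewrite inE xu /= (eq_sym u).
Qed.

(** Two-step induction on the recurrence, from the identity and [A]. Symmetry and commutation are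
    proved together, because transposing [A N_(k+1)] gives [N_(k+1) A]. *)
Lemma symcomm_nbcount k : symcomm (fun x => nbcount k x x).
Proof.
have self (F : G -> nat) u : \sum_(z | adj u z && (z != u)) F z = \sum_(z | adj u z) F z.
  apply: eq_bigl => z; case: (z =P u) => [->|]; last by rewrite andbT.
  by rewrite adj_irrefl.
have s0 x y : nbcount 0 x x y = (x == y) by rewrite /nbcount /= addn0.
have s1 x y : nbcount 1 x x y = adj x y.
  rewrite nbcountS self big_mkcond (bigD1 y) //= big1 => [|z /negPf zy].
    by rewrite /nbcount /= eqxx addn0; case: adj.
  by rewrite /nbcount /= zy; case: adj.
have c0 : symcomm (fun x => nbcount 0 x x).
  split=> x y; first by rewrite !s0 eq_sym.
  rewrite /lsum /rsum; under eq_bigr do rewrite s0.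
  under [RHS]eq_bigr do rewrite s0.
  rewrite big_mkcond (bigD1 y) //= [RHS]big_mkcond [RHS](bigD1 x) //= !eqxx.
  rewrite [X in _ + X]big1 => [|z /negPf ->]; last by case: ifP.
  rewrite [X in _ = _ + X]big1 => [|z]; last first.
    by rewrite eq_sym => /negPf ->; case: ifP.
  by rewrite adj_sym.
have c1 : symcomm (fun x => nbcount 1 x x).
  split=> x y; first by rewrite !s1 adj_sym.
  rewrite /lsum /rsum; under eq_bigr do rewrite s1.
  under [RHS]eq_bigr do rewrite s1.
  by rewrite big_mkcond [RHS]big_mkcond; apply: eq_bigr => z _; rewrite (adj_sym z y); do 2 case: adj.
suff: symcomm (fun x => nbcount k x x) /\ symcomm (fun x => nbcount k.+1 x x) by case.
elim: k => [|k [[sk ck] [sk1 ck1]]] //; split=> //.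
set c := if k is 0 then d else d - 1.
have E x y : nbcount k.+2 x x y + c * nbcount k x x y =
    lsum (fun z => nbcount k.+1 z z) x y by rewrite lsum_nbcount.
split=> x y.
  apply: (@addIn (c * nbcount k x x y)); rewrite E sk E ck1.
  by apply: eq_bigr => z _; rewrite sk1.
(* Adding back the [N_k] term reduces the claim to [A (A N_(k+1)) = (A N_(k+1)) A]. *)
apply: (@addIn (c * lsum (fun z => nbcount k z z) x y)).
rewrite {2}ck /lsum /rsum !big_distrr /= -!big_split /=.
under eq_bigr do rewrite E.
under [RHS]eq_bigr do rewrite E.
rewrite /lsum [RHS]exchange_big /=.
by apply: eq_bigr => z _; apply: ck1.
Qed.

End Counting.

(** * Cycles *)

Section CycleIndexing.

Variables (G : sgraph) (x0 : G) (c : seq G).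
Hypothesis hc : graph_cycle c.

(** Indices wrap around, so arcs may run past the end of the list. Since a cycle is non-empty, the
    default [x0] is never returned. *)
Definition cyc i := nth x0 c (i %% size c).

Let m_gt0 : 0 < size c.
Proof. by case: hc => _; apply: leq_trans. Qed.

Lemma cyc_in i : cyc i \in c.
Proof. by rewrite mem_nth // ltn_mod. Qed.

Lemma cycP x : x \in c -> exists2 i, i < size c & x = cyc i.
Proof.
move=> xc; exists (index x c); first by rewrite index_mem.
by rewrite /cyc modn_small ?index_mem // nth_index.
Qed.

Lemma cyc_eq i j : (cyc i == cyc j) = (i == j %[mod size c]).
Proof. by case: hc => /andP[_ uc] _; rewrite nth_uniq // ltn_mod. Qed.

Lemma cyc_mod i j : i = j %[mod size c] -> cyc i = cyc j.
Proof. by move=> h; apply/eqP; rewrite cyc_eq h. Qed.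

Lemma cyc_adj i : adj (cyc i) (cyc i.+1).
Proof.
have [/andP[ec _] _] := hc.
rewrite /cyc -(addn1 i) -modnDml addn1.
have := ltn_pmod i m_gt0; move: (i %% size c) => k {i}.
case: c ec => [|x s] // /(pathP x0) /= hs; rewrite ltnS => ks.
have := hs k; rewrite size_rcons ltnS => /(_ ks).
rewrite -rcons_cons !nth_rcons /= ltnS ks.
move: ks; rewrite leq_eqVlt => /predU1P[->|ks].
  by rewrite ltnn eqxx modnn.
by rewrite ks modn_small.
Qed.

Lemma cyc_neq2 i : cyc i != cyc i.+2.
Proof.
rewrite cyc_eq -{1}(addn0 i) -(addn2 i) eqn_modDl mod0n modn_small //.
by case: hc.
Qed.

(* Stepping by [size c - 1] modulo [size c] runs the cycle backwards. *)
Let cycb i j := cyc (i + (size c).-1 * j).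

Let cycbE i j : cyc (i + (size c).-1 * j + j) = cyc i.
Proof. by apply: cyc_mod; rewrite -addnA addnC -mulSnr prednK // mulnC modnMDl. Qed.

Let cycbS i j : cyc (i + (size c).-1 * j.+1).+1 = cycb i j.
Proof.
apply: cyc_mod; rewrite mulnS [_.-1 + _]addnC addnA -addnS prednK //.
by rewrite modnDr.
Qed.

Let cycbS2 i j : cyc (i + (size c).-1 * j.+2).+2 = cycb i j.
Proof.
rewrite -cycbS; apply: cyc_mod.
rewrite mulnS [_.-1 + _]addnC addnA -[(_ + _.-1).+1]addnS prednK //.
by rewrite -addSn modnDr.
Qed.

(** The two arcs leave [cyc i] through its two neighbours on the cycle, which differ because a cycle
    has at least three vertices. *)
Lemma cyc_arcs i h : 0 < h < size c -> exists s1 s2,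
  [/\ nbwalk (cyc i) s1 (cyc (i + h)), nbwalk (cyc i) s2 (cyc (i + h)),
      size s1 = h /\ size s2 = size c - h,
      head (cyc i) s1 != head (cyc i) s2 &
      {subset s1 <= c} /\ {subset s2 <= c}].
Proof.
case/andP=> h0 hm.
have e0 : cycb i 0 = cyc i by rewrite /cycb muln0 addn0.
exists [seq cyc (i + j) | j <- iota 1 h], [seq cycb i j | j <- iota 1 (size c - h)].
have fw j : adj (cyc (i + j)) (cyc (i + j.+1)) by rewrite addnS cyc_adj.
have bw j : adj (cycb i j) (cycb i j.+1) by rewrite adj_sym -(cycbS i j) cyc_adj.
split; rewrite ?size_map ?size_iota //.
- apply/and3P; split.
  + by rewrite -[in path _ _]((addn0 i)); apply: path_map_iota.
  + rewrite -{1}(addn0 i) -[_ :: _]/[seq cyc (i + j) | j <- iota 0 h.+1].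
    by apply: nobt_map_iota => j; rewrite !addnS cyc_neq2.
  + by rewrite -{1}(addn0 i) (last_map_iota (fun j => cyc (i + j))).
- rewrite -{1}e0; apply/and3P; split.
  + exact: path_map_iota.
  + rewrite -[_ :: _]/[seq cycb i j | j <- iota 0 (size c - h).+1].
    by apply: nobt_map_iota => j; rewrite -cycbS2 eq_sym cyc_neq2.
  + rewrite last_map_iota add0n; apply/eqP.
    rewrite -(cycbE (i + h) (size c - h)); apply: cyc_mod.
    by rewrite (addnAC i) -addnA subnKC ?(ltnW hm) // modnDr.
- have : 0 < size c - h by rewrite subn_gt0.
  case: h h0 {hm} => // h _; case: (size c - h.+1) => // k _ /=.
  have -> : cyc (i + 1) = cyc (i + (size c).-1 * 1).+2.
    apply: cyc_mod; have -> : (i + (size c).-1 * 1).+2 = i.+1 + size c.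
      by rewrite muln1 -[in RHS](prednK m_gt0) addSn addnS.
    by rewrite modnDr addn1.
  by rewrite eq_sym cyc_neq2.
- by split=> x /mapP[j _ ->]; apply: cyc_in.
Qed.

End CycleIndexing.

(** * Repeats in graphs of defect 2 *)

Section Repeats.

Variables (d D : nat) (G : sgraph).
Hypotheses (hd : 4 <= d) (hD : 4 <= D) (hG : defect_graph d D 2 G).
Implicit Types (x y z : G) (s t p q : seq G).

Lemma degree_le x : degree x <= d.
Proof. by case: hG => <- _ _; exact: leq_bigmax. Qed.

(** A walk realising the distance shortens to a simple path, which cannot backtrack. *)
Lemma shortcount_gt0 x y : 0 < shortcount D x y.
Proof.
case: hG => _ [dist _] _; have [n [[p [pp lp sp]] _] nD] := dist x y.
case/shortenP: pp lp => q pq uq sub lq.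
apply: (shortcount_ge (L := [:: q])) => // s; rewrite inE => /eqP ->.
rewrite /nbwalk pq (uniq_nobt uq) lq eqxx /=.
apply: leq_trans nD; rewrite -sp; apply: uniq_leq_size => //.
by case/andP: uq.
Qed.

(** With [S] the geometric sum, a vertex of degree below [d] reaches at most [1 + (d - 1) * S]
    vertices, which is [S] short of the Moore bound, while the order is only [2] short. *)
Lemma degree_reg x : degree x = d.
Proof.
apply/eqP; rewrite eqn_leq degree_le leqNgt; apply/negP => lt.
case: hG => _ _; rewrite /moore_bound => hM.
have h1 : #|G| <= 1 + degree x * \sum_(i < D) (d - 1) ^ i.
  apply: leq_trans (size_nbshort_le D x degree_le).
  rewrite -sum_shortcount -sum1_card; apply: leq_sum => y _.
  exact: shortcount_gt0.
(* The first two terms, [1] and [d - 1], already add up to at least [4]. *)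
have h2 : 2 < \sum_(i < D) (d - 1) ^ i.
  case: D hD => [|[|k]] // _; rewrite 2!big_ord_recl /= expn0 expn1 /bump /=.
  by move: hd; case: d => [|[|[|[|]]]].
move: h1 h2 hM; set S := \sum_(i < D) _ => h1 h2 hM.
have : (degree x).+1 * S <= d * S by rewrite leq_mul2r lt orbT.
rewrite mulSn => h3; have : 1 + degree x * S + 2 < 1 + d * S.
  by rewrite addnAC -addnA ltn_add2l; apply: leq_trans h3; rewrite ltn_add2r.
by rewrite -hM ltn_add2r ltnNge h1.
Qed.

(** The matrix counting short walks minus the all-ones matrix. The predecessor does not truncate, by
    [shortcount_gt0]. *)
Definition excess x y := (shortcount D x y).-1.

Lemma shortcountE_excess x y : shortcount D x y = (excess x y).+1.
Proof. by rewrite prednK // shortcount_gt0. Qed.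

(** By regularity the short walks from [x] number exactly the Moore bound, [#|G| + 2]; one walk per
    vertex accounts for all but two. *)
Lemma sum_excess x : \sum_y excess x y = 2.
Proof.
have := sum_shortcount D x; rewrite (size_nbshort_reg D x degree_reg).
case: hG => _ _; rewrite /moore_bound => <-.
under eq_bigr do rewrite shortcountE_excess -addn1.
rewrite big_split /= sum1_card addnC; exact: addnI.
Qed.

Lemma symcomm_shortcount : symcomm (fun x y : G => shortcount D x y).
Proof.
split=> x y; rewrite /lsum /rsum ?shortcountE.
  by apply: eq_bigr => k _; exact: (proj1 (symcomm_nbcount degree_reg k)).
under eq_bigr do rewrite shortcountE.
under [RHS]eq_bigr do rewrite shortcountE.
rewrite exchange_big [RHS]exchange_big; apply: eq_bigr => k _.
exact: (proj2 (symcomm_nbcount degree_reg k)).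
Qed.

Definition repeats x y := 0 < excess x y.

Lemma repeats_sym x y : repeats x y = repeats y x.
Proof. by rewrite /repeats /excess (proj1 symcomm_shortcount). Qed.

Lemma repeats_shortcount x y : repeats x y = (1 < shortcount D x y).
Proof. by rewrite shortcountE_excess. Qed.

Lemma repeats_uniq_le2 x (l : seq G) :
  uniq l -> {in l, forall y, repeats x y} -> size l <= 2.
Proof.
move=> ul hl; rewrite -(sum_excess x) -sum1_size.
apply: (@leq_trans (\sum_(y <- l) excess x y)).
  by rewrite big_seq [leqRHS]big_seq; apply: leq_sum => y /hl.
by rewrite big_uniq // [leqRHS](bigID (mem l)) /= leq_addr.
Qed.

(** Of the total excess [2], the repeat [z] takes at least one unit. *)
Lemma shortcount_le2 x y z : y != z -> repeats x z ->
  shortcount D x y <= 2.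
Proof.
move=> yz hz; rewrite shortcountE_excess ltnS.
have := sum_excess x; rewrite (bigD1 y) // (bigD1 z) /=; last by rewrite eq_sym.
move: hz; rewrite /repeats; case: (excess x z) => // k _; case: (excess x y) => [|[|n]] //.
by rewrite !addSn !addnS.
Qed.

(* The excess matrix commutes with the adjacency matrix. *)
Lemma repeats_next x y x' : repeats x y -> adj x x' ->
  exists2 y', repeats x' y' & adj y y'.
Proof.
move=> xy xx'.
have e : \sum_(z | adj x' z) excess z y = \sum_(z | adj y z) excess x' z.
  have := proj2 symcomm_shortcount x' y; rewrite /lsum /rsum.
  under eq_bigr do rewrite shortcountE_excess -addn1.
  under [RHS]eq_bigr do rewrite shortcountE_excess -addn1.
  rewrite !big_split /= !sum1_card.
  (* The all-ones matrix contributes a degree on each side, and these agree by regularity. *)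
  have dg z : #|[pred u | adj z u]| = d.
    by rewrite -(degree_reg z); apply: eq_card => u; rewrite !inE.
  by rewrite !dg; exact: addIn.
have : 0 < \sum_(z | adj y z) excess x' z.
  by rewrite -e (bigD1 x) /= 1?adj_sym // addn_gt0 -/(repeats x y) xy.
rewrite lt0n sum_nat_eq0 negb_forall => /existsP[y'].
by rewrite negb_imply -lt0n => /andP[h1 h2]; exists y'.
Qed.

(** The last clause serves to show that lifts of paths off a cycle stay off it. *)
Lemma repeats_path x y s : repeats x y -> path (@adj G) x s ->
  exists t, [/\ path (@adj G) y t, size t = size s,
    repeats (last x s) (last y t) &
    {in y :: t, forall v, exists2 u, u \in x :: s & repeats u v}].
Proof.
elim: s x y => [|a s IH] x y xy.
  move=> _; exists [::]; split=> // v; rewrite inE => /eqP ->.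
  by exists x; rewrite ?mem_head.
case/andP=> xa hs; have [b ab yb] := repeats_next xy xa.
have [t [pt st lt ht]] := IH a b ab hs; exists (b :: t); split=> //=.
- by rewrite yb.
- by rewrite st.
move=> v; rewrite inE => /predU1P[->|/ht[u hu uv]].
  by exists x; rewrite ?mem_head.
by exists u => //; rewrite inE hu orbT.
Qed.

Lemma nbwalks_repeats x y s1 s2 : s1 != s2 -> nbwalk x s1 y -> nbwalk x s2 y ->
  size s1 <= D -> size s2 <= D -> repeats x y.
Proof.
move=> ne h1 h2 l1 l2; rewrite repeats_shortcount.
apply: (shortcount_ge (L := [:: s1; s2])) => [|s]; first by rewrite /= inE ne.
by rewrite !inE => /orP[] /eqP ->; rewrite ?h1 ?h2.
Qed.

Lemma two_outside_pair (A : pred G) a b : 3 < #|A| ->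
  exists z1 z2, [/\ z1 != z2, A z1, A z2, z1 \notin [:: a; b] & z2 \notin [:: a; b]].
Proof.
move=> hA; pose B := [set z in A | z \notin [:: a; b]].
have : 1 < #|B|.
  have hB : [set z in A] = B :|: [set z in A | z \in [:: a; b]].
    by apply/setP => z; rewrite !(in_setU, in_set) -andb_orr orNb andbT.
  have : #|[set z in A]| <= #|B| + 2.
    rewrite hB; apply: leq_trans (leq_card_setU _ _) _; rewrite leq_add2l.
    apply: leq_trans (subset_leq_card _) (card_size [:: a; b]).
    by apply/subsetP => z; rewrite in_set => /andP[].
  by rewrite cardsE => /(leq_trans hA); rewrite addn2 !ltnS.
case/card_gt1P=> z1 [z2 [h1 h2 ne]]; exists z1, z2.
by move: h1 h2; rewrite !in_set => /andP[h1 h1'] /andP[h2 h2'].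
Qed.

(** As [d >= 4], at least two neighbours of [y] avoid both penultimate vertices. Extending both
    walks to these makes them repeats of [x], and [y] is a third. *)
Lemma nbwalk_unique x y s1 s2 : nbwalk x s1 y -> nbwalk x s2 y ->
  size s1 < D -> size s2 < D -> s1 = s2.
Proof.
move=> h1 h2 l1 l2; apply/eqP/negPn/negP => ne.
have : 3 < #|[pred z | adj y z]|.
  apply: leq_trans hd _; rewrite -(degree_reg y) leq_eqVlt; apply/orP; left.
  by apply/eqP/eq_card => z; rewrite !inE.
case/(two_outside_pair (last x (belast x s1)) (last x (belast x s2)))=> z1 [z2 [zz a1 a2 n1 n2]].
have ext z : adj y z -> z \notin [:: last x (belast x s1); last x (belast x s2)] -> repeats x z.
  rewrite !inE negb_or => yz /andP[m1 m2].
  apply: (@nbwalks_repeats _ _ (rcons s1 z) (rcons s2 z)); rewrite ?size_rcons //.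
  - by rewrite eqseq_rcons eqxx andbT.
  - by apply: nbwalk_rcons h1 yz _; rewrite eq_sym.
  - by apply: nbwalk_rcons h2 yz _; rewrite eq_sym.
have : size [:: y; z1; z2] <= 2; last by [].
apply: (@repeats_uniq_le2 x) => [|z].
  rewrite /= !inE zz andbT negb_or; apply/andP; split=> //.
  by apply/andP; split; [move: a1|move: a2]; apply: contraTneq => <-; rewrite /= adj_irrefl.
rewrite !inE => /or3P[] /eqP ->; last exact: ext.
  by apply: (nbwalks_repeats ne) => //; apply: ltnW.
exact: ext.
Qed.

(** Deleting a common first step would leave distinct walks of length below [D] with the same
    ends. *)
Lemma nbwalk_head_neq x y s1 s2 : s1 != s2 -> nbwalk x s1 y -> nbwalk x s2 y ->
  size s1 <= D -> size s2 <= D -> head x s1 != head x s2.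
Proof.
case: s1 s2 => [|a s1] [|b s2] // ne h1 h2 l1 l2 /=.
- by case/and3P: h2 => /= /andP[xb _] _ _; apply: contraTneq xb => <-; rewrite adj_irrefl.
- by case/and3P: h1 => /= /andP[xa _] _ _; apply: contraTneq xa => ->; rewrite adj_irrefl.
apply: contraNneq ne => ab; rewrite -{}ab in h2 *; apply/eqP; congr cons.
have [_ /= h1'] := @nbwalk_split _ x [:: a] s1 y h1.
have [_ /= h2'] := @nbwalk_split _ x [:: a] s2 y h2.
exact: nbwalk_unique h1' h2' l1 l2.
Qed.

Lemma nbwalk_last_neq x y s1 s2 : s1 != s2 -> nbwalk x s1 y -> nbwalk x s2 y ->
  size s1 <= D -> size s2 <= D -> last x (belast x s1) != last x (belast x s2).
Proof.
move=> ne h1 h2 l1 l2.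
have e1 : last x s1 = y by case/and3P: h1 => _ _ /eqP.
have e2 : last x s2 = y by case/and3P: h2 => _ _ /eqP.
rewrite -(head_rev_belast e1) -(head_rev_belast e2).
apply: (nbwalk_head_neq _ (nbwalk_rev h1) (nbwalk_rev h2));
  rewrite ?size_rev ?size_belast //.
by apply: contraNneq ne => e; rewrite -(rev_belastK e1) e (rev_belastK e2).
Qed.

(** The two walks form a closed walk of length [2 * D] without backtracking at [x] or [y]; it is cut
    here at another pair of opposite positions. One new walk passes through [x], the other through
    [y]. *)
Lemma antipodal_walks x y p1 p2 q1 q2 :
  nbwalk x (p1 ++ p2) y -> nbwalk x (q1 ++ q2) y -> p1 ++ p2 != q1 ++ q2 ->
  size (p1 ++ p2) = D -> size (q1 ++ q2) = D ->
  0 < size p1 < D -> size p1 + size q1 = D ->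
  exists s1 s2, [/\ s1 != s2, nbwalk (last x p1) s1 (last x q1),
    nbwalk (last x p1) s2 (last x q1), size s1 = D & size s2 = D].
Proof.
move=> hp hq ne sp sq /andP[p0 pD] s11.
have hh : head x (p1 ++ p2) != head x (q1 ++ q2).
  by apply: nbwalk_head_neq hp hq _ _; rewrite ?sp ?sq.
have hl : last x (belast x (p1 ++ p2)) != last x (belast x (q1 ++ q2)).
  by apply: nbwalk_last_neq hp hq _ _; rewrite ?sp ?sq.
have q0 : 0 < size q1 by rewrite -(ltn_add2l (size p1)) addn0 s11.
have p20 : 0 < size p2 by rewrite -(ltn_add2l (size p1)) addn0 -size_cat sp.
have qD : size q1 < D by rewrite -s11 -{1}(add0n (size q1)) ltn_add2r.
have q20 : 0 < size q2 by rewrite -(ltn_add2l (size q1)) addn0 -size_cat sq.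
have turn : last x (belast x p1) != head x p2.
  apply: nobt_turn; rewrite -?size_eq0 -?lt0n //.
  by case/and3P: hp.
have [hp1 hp2] := nbwalk_split hp; have [hq1 hq2] := nbwalk_split hq.
have e2 : last (last x p1) p2 = y by case/and3P: hp2 => _ _ /eqP.
have f2 : last (last x q1) q2 = y by case/and3P: hq2 => _ _ /eqP.
exists (rev (belast x p1) ++ q1), (p2 ++ rev (belast (last x q1) q2)); split.
- apply: contraNneq turn => /(congr1 (head x)).
  have -> : head x (rev (belast x p1) ++ q1) = last x (belast x p1).
    rewrite -(head_rev_belast (erefl (last x p1))).
    by case: p1 p0 {hp ne sp hh hl s11 pD hp1 hp2 e2} => //= a u _; rewrite lastI rev_rcons.
  by move=> ->; case: p2 p20 {hp ne sp hh hl hp2 e2}.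
- apply: nbwalk_glue => //; move: hh.
  by case: p1 p0 {hp hl sp s11 ne turn pD hp1 hp2 e2} => //; case: q1 q0 {hq sq qD hq1 hq2 f2}.
- have := nbwalk_glue (nbwalk_rev hp2) (nbwalk_rev hq2).
  rewrite (rev_belastK e2) (head_rev_belast e2) (head_rev_belast f2); apply.
  move: hl; rewrite !belast_cat !last_cat.
  case: p2 p20 {hp ne sp hh hp2 e2 turn} => // a u _.
  by case: q2 q20 {hq sq hq2 f2} => // b v _.
- by rewrite size_cat size_rev size_belast.
- by move: s11 sp sq; rewrite !size_cat size_rev size_belast; clear; lia.
Qed.

(** In a shorter cycle both arcs between (nearly) opposite vertices have length below [D], against
    [nbwalk_unique]. *)
Lemma girth_ge (c : seq G) : graph_cycle c -> 2 * D <= (size c).+1.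
Proof.
move=> hc; have [_ c2] := hc; case: c c2 hc => [|x0 c'] // c2; set c := x0 :: c' in c2 *.
move=> hc; rewrite leqNgt; apply/negP => lt.
have h1 : 0 < (size c)./2 < size c by lia.
have [s1 [s2 [w1 w2 [e1 e2] hh _]]] := cyc_arcs x0 hc 0 h1.
case/negP: hh; apply/eqP; congr head; apply: nbwalk_unique w1 w2 _ _.
  by rewrite e1; lia.
by rewrite e2; lia.
Qed.

(** * Excluding cycles of length 2D - 1 *)

Section OddCycle.

Variables (x0 : G) (c : seq G).
Hypotheses (hc : graph_cycle c) (size_c : (size c).+1 = 2 * D).

Let C := cyc x0 c.

(** On [2 * D - 1] vertices, moving [D] forwards is moving [D - 1] backwards. The shorter arc is
    always listed first. *)
Lemma odd_cycle_arcs i h : h = D.-1 \/ h = D -> exists s1 s2,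
  [/\ nbwalk (C i) s1 (C (i + h)), nbwalk (C i) s2 (C (i + h)),
      size s1 = D.-1, size s2 = D &
      {subset s1 <= c} /\ {subset s2 <= c}].
Proof.
move=> hh; have h1 : 0 < h < size c by case: hh; lia.
have [s1 [s2 [w1 w2 [e1 e2] _ [b1 b2]]]] := cyc_arcs x0 hc i h1.
case: hh => hh; [exists s1, s2 | exists s2, s1]; split=> //; lia.
Qed.

Lemma cyc_repeats i h : h = D.-1 \/ h = D -> repeats (C i) (C (i + h)).
Proof.
case/(odd_cycle_arcs i) => s1 [s2 [w1 w2 e1 e2 _]].
apply: nbwalks_repeats w1 w2 _ _; rewrite ?e1 ?e2 ?leq_pred //.
by apply: contra_eq_neq e1 => ->; rewrite e2; lia.
Qed.

Lemma cyc_antipodes i : C (i + D.-1) != C (i + D).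
Proof. by rewrite cyc_eq // eqn_modDl !modn_small; lia. Qed.

Lemma cyc_repeatsP i y : repeats (C i) y -> exists2 h, h = D.-1 \/ h = D & y = C (i + h).
Proof.
move=> hy; case: (y =P C (i + D.-1)) => [->|/eqP n1]; first by exists D.-1; [left|].
case: (y =P C (i + D)) => [->|/eqP n2]; first by exists D; [right|].
have : size [:: y; C (i + D.-1); C (i + D)] <= 2; last by [].
apply: (@repeats_uniq_le2 (C i)) => [|z].
  by rewrite /= !inE negb_or n1 n2 cyc_antipodes.
by rewrite !inE => /or3P[] /eqP -> //; apply: cyc_repeats; [left|right].
Qed.

(** A cycle vertex has all its repeats on the cycle, and the relation is symmetric. *)
Lemma repeats_in_cycle x y : repeats x y -> (x \in c) = (y \in c).
Proof.
have half u v : repeats u v -> u \in c -> v \in c.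
  by move=> uv /(cycP x0)[i _ e]; move: uv; rewrite e => /cyc_repeatsP[h _ ->]; apply: cyc_in.
move=> xy; apply/idP/idP; first exact: half xy.
by apply: half; rewrite repeats_sym.
Qed.

(** The other antipode of [x] takes one unit of excess, so [y] is reached by only two short walks,
    namely the two arcs. *)
Lemma cycle_walks x y s : x \in c -> repeats x y -> nbwalk x s y -> size s <= D ->
  exists s1 s2, [/\ size s1 = D.-1, size s2 = D, {subset s1 <= c}, {subset s2 <= c}
                  & s = s1 \/ s = s2] /\
    (forall s', nbwalk x s' y -> size s' <= D -> s' = s1 \/ s' = s2).
Proof.
case/(cycP x0)=> i _ -> hr; have [h hh ey] := cyc_repeatsP hr; rewrite {}ey in hr *.
have [s1 [s2 [w1 w2 e1 e2 [b1 b2]]]] := odd_cycle_arcs i hh.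
have arc s' : nbwalk (C i) s' (C (i + h)) -> size s' <= D -> s' = s1 \/ s' = s2.
  move=> w' l'; case: (s' =P s1) => [|/eqP n1]; first by left.
  case: (s' =P s2) => [|/eqP n2]; first by right.
  have [y' ne hr'] : exists2 y', C (i + h) != y' & repeats (C i) y'.
    case: hh => ->; [exists (C (i + D)) | exists (C (i + D.-1))];
      rewrite ?cyc_antipodes 1?eq_sym ?cyc_antipodes //; apply: cyc_repeats; by [left|right].
  have := shortcount_le2 ne hr'; rewrite leqNgt => /negP[].
  apply: (shortcount_ge (L := [:: s'; s1; s2])) => [|t].
    rewrite /= !inE negb_or n1 n2 /= andbT.
    by apply: contra_eq_neq e1 => ->; rewrite e2; lia.
  by rewrite !inE => /or3P[] /eqP ->; rewrite ?w' ?l' ?w1 ?w2 ?e1 ?e2 ?leq_pred ?leqnn.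
by move=> ws ls; exists s1, s2; split; [split=> // |]; apply: arc.
Qed.

Lemma cycle_walk_subset x y s : x \in c -> repeats x y -> nbwalk x s y -> size s <= D ->
  {subset s <= c}.
Proof. by move=> xc hr w l; have [s1 [s2 [[_ _ b1 b2 [] -> //]]]] := cycle_walks xc hr w l. Qed.

Lemma cycle_walk_unique x y s s' : x \in c -> nbwalk x s y -> nbwalk x s' y ->
  size s = D -> size s' = D -> s = s'.
Proof.
move=> xc w w' l l'; apply/eqP/negPn/negP => ne.
have hr : repeats x y by apply: nbwalks_repeats ne w w' _ _; rewrite ?l ?l'.
have [s1 [s2 [[e1 e2 _ _ h] arc]]] := cycle_walks xc hr w (eq_leq l).
case/negP: ne; apply/eqP; case: h => h; first by move: l; rewrite h e1; lia.
case: (arc _ w' (eq_leq l')) => h'; first by move: l'; rewrite h' e1; lia.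
by rewrite h h'.
Qed.

(* A short connection off the cycle would close up to a cycle through the edge from
   [C i] to [u] of length at most [2 * D]. Its two halves from [C i] are distinct, so
   their common end is a repeat of [C i], and they would have to run along [c]. *)
Lemma cycle_paths_far i j u v t :
  adj (C i) u -> adj (C (i + j)) v -> path (@adj G) u t -> last u t = v ->
  {in u :: t, forall z, z \notin c} -> (C i != C (i + j)) || (u != v) ->
  2 * D < size t + 2 + j.
Proof.
move=> iu jv pt lt off ne; rewrite ltnNge; apply/negP => short.
set a := C i; set b := C (i + j).
(* Adjacency without the edge from [a] to [u]: a simple path from [u] to [a] along [e] closes up
   with that edge. *)
pose e x y := adj x y && ~~ [|| (x == a) && (y == u) | (x == u) && (y == a)].
have ac : a \in c by exact: cyc_in.
have bc : b \in c by exact: cyc_in.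
have uc : u \notin c by apply: off; rewrite mem_head.
have vc : v \notin c by apply: off; rewrite -lt mem_last.
have au : a != u by apply: contraNneq uc => <-.
pose w := [seq C (i + k) | k <- iota 1 j].
have pw : path (@adj G) a w.
  rewrite /a -{1}(addn0 i); apply: path_map_iota => k; rewrite addnS.
  exact: cyc_adj.
have lw : last a w = b by rewrite /a -{1}(addn0 i) (last_map_iota (fun k => C (i + k))).
have wc : {subset a :: w <= c}.
  move=> x; rewrite inE => /predU1P[->//|/mapP[k _ ->]]; exact: cyc_in.
have pb : path e b (rev (belast a w)).
  have : path (@adj G) b (rev (belast a w)) by rewrite -lw path_rev_adj.
  apply: (@sub_in_path _ (mem c)).
    move=> x y xc yc xy; rewrite /e xy /=.
    have [/negPf -> /negPf ->] : x != u /\ y != u by split; apply: contraNneq uc => <-.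
    by rewrite andbF.
  apply/andP; split; first exact: bc.
  by apply/allP => x; rewrite mem_rev => /mem_belast; exact: wc.
have pu : path e u t.
  apply: (@sub_in_path _ [predC c]) pt; last first.
    by apply/allP => x /off; rewrite inE.
  move=> x y; rewrite !inE => xc yc xy; rewrite /e xy /=.
  have [/negPf -> /negPf ->] : x != a /\ y != a.
    by split; [apply: contraNneq xc | apply: contraNneq yc] => ->.
  by rewrite andbF.
(* The last hypothesis says precisely that the two connecting edges are not the same edge. *)
have vb : e v b.
  rewrite /e adj_sym jv /= negb_or !negb_and.
  have -> /= : v != a by apply: contraNneq vc => ->.
  by case/orP: ne => h; rewrite 1?(eq_sym v) 1?(eq_sym b) h ?orbT.
have pall : path e u (t ++ b :: rev (belast a w)).
  by rewrite cat_path pu lt /= vb pb.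
have lall : last u (t ++ b :: rev (belast a w)) = a.
  rewrite last_cat /= -lw; case: (w) => [|z w'] //=.
  by rewrite rev_cons last_rcons.
have sall : size (t ++ b :: rev (belast a w)) = size t + j.+1.
  by rewrite size_cat /= size_rev size_belast size_map size_iota.
case/shortenP: pall lall => q pq uq sub lq.
have sq : size q <= size t + j.+1.
  by rewrite -sall; apply: uniq_leq_size => //; case/andP: uq.
case/lastP: q pq uq sub lq sq => [|q' a'] pq uq sub.
  by move=> /= ua; rewrite ua eqxx in au.
rewrite last_rcons => ea; rewrite {}ea {a'} in pq uq sub *.
rewrite size_rcons => sq.
have subadj : subrel e (@adj G) by move=> x y /andP[].
have wq : nbwalk a (u :: rcons q' a) a.
  apply/and3P; split; last by rewrite /= last_rcons.
    by rewrite /= iu (sub_path subadj pq).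
  rewrite /= -/(nobt (u :: rcons q' a)) (uniq_nobt uq) andbT.
  case: q' pq uq {sub sq} => [|z q'] /=; first by rewrite /e !eqxx !orbT andbF.
  move=> _ /and3P[_ + _]; rewrite mem_rcons inE negb_or eq_sym => /andP[-> _].
  by [].
(* The closed walk leaves [a] through [u] but does not return through [u], so its two halves, both
   read from [a], differ. *)
have pen : last u q' != u.
  move: pq; rewrite rcons_path => /andP[_]; rewrite /e eqxx andbT.
  by case/andP=> _; rewrite negb_or => /andP[].
(* The closed walk has length [(size q').+2], at most [2 * D], and is cut in the middle. *)
have [h [h0 h1 h2 h3]] : exists h, [/\ 0 < h, h <= (size q').+1, h <= D
    & (size q').+2 - h <= D].
  by exists (size q').+2./2; move: sq short; clear; move: (size q') (size t); split; lia.
have e1 : u :: rcons q' a = take h (u :: q') ++ rcons (drop h (u :: q')) a.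
  by rewrite -rcons_cat cat_take_drop.
rewrite e1 in wq; have [w1 w2] := nbwalk_split wq.
set y := last a (take h (u :: q')) in w1 w2.
have w2r := nbwalk_rev w2.
have hr : repeats a y.
  apply: nbwalks_repeats w1 w2r _ _.
  - apply: contraNneq pen => /(congr1 (head a)).
    rewrite (_ : head a (take _ _) = u); last by case: (h) h0.
    rewrite head_rev_belast ?last_rcons // belast_rcons last_cons => e'.
    by apply/eqP; rewrite [RHS]e' /y -last_cat cat_take_drop.
  - by rewrite size_take_min geq_min h2.
  - by rewrite size_rev size_belast size_rcons size_drop /= -subSn.
case/negP: uc; apply: (cycle_walk_subset ac hr w1).
  by rewrite size_take_min geq_min h2.
by case: (h) h0 => // k _; exact: mem_head.
Qed.
(** A neighbour other than the two along the cycle is off it: a chord and the shorter arc it spans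
    would contradict [nbwalk_unique]. *)
Lemma off_cycle_neighbour i : exists2 u, adj (C i) u & u \notin c.
Proof.
have : 3 < #|[pred z | adj (C i) z]|.
  apply: leq_trans hd _; rewrite -(degree_reg (C i)) leq_eqVlt; apply/orP; left.
  by apply/eqP/eq_card => z; rewrite !inE.
case/(two_outside_pair (C (i + 1)) (C (i + (size c).-1)))=> u [_ [_ au _ nu _]].
exists u => //; apply: contra nu => /(cycP x0)[k0 _ ek].
(* The index is made relative to [i]; modulo [size c], the summand [(size c).-1 * i] is [- i]. *)
have [k km eu] : exists2 k, k < size c & u = C (i + k).
  have m0 : 0 < size c by lia.
  exists ((k0 + (size c).-1 * i) %% size c); first by rewrite ltn_mod.
  rewrite ek; apply: cyc_mod; first exact: hc.
  rewrite modnDmr addnCA -{1}(mul1n i) -mulnDl add1n prednK // addnC mulnC.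
  by rewrite modnMDl.
have k0' : 0 < k.
  by case: k {km} eu au => // ->; rewrite addn0 /= adj_irrefl.
have [|s1 [s2 [w1 w2 [e1 e2] _ _]]] := cyc_arcs x0 hc i (h := k); first by rewrite k0'.
have wu : nbwalk (C i) [:: u] u by rewrite /nbwalk /= andbT eqxx andbT.
rewrite -/C -eu in w1 w2.
case: (ltnP k D) => kD.
  have e : s1 = [:: u] by apply: nbwalk_unique w1 wu _ _; [rewrite e1 | apply: leq_trans hD].
  have -> : u = C (i + 1) by rewrite eu -e1 e.
  exact: mem_head.
have e : s2 = [:: u] by apply: nbwalk_unique w2 wu _ _; [rewrite e2; move: kD size_c; clear; lia | apply: leq_trans hD].
have -> : u = C (i + (size c).-1).
  by rewrite eu; congr (C (i + _)); move: e2 km; rewrite e /=; clear; lia.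
by rewrite !inE eqxx orbT.
Qed.

(** If an inner vertex [z] of [p] were on the cycle, recutting the closed walk at [z] would give two
    walks of length [D] from [z], against [cycle_walk_unique]. *)
Lemma antipodal_off_cycle x y p q : x \notin c -> y \notin c -> p != q ->
  nbwalk x p y -> nbwalk x q y -> size p = D -> size q = D ->
  {in x :: p, forall z, z \notin c}.
Proof.
move=> xc yc ne hp hq sp sq z; rewrite inE => /predU1P[->//|].
move=> zp; case/splitPr: zp hp sp ne => p1' p2'; rewrite -cat_rcons; set p1 := rcons p1' z => hp sp ne.
case: (posnP (size p2')) => [/size0nil p20|p20].
  by move: hp; rewrite p20 cats0 => /and3P[_ _]; rewrite last_rcons => /eqP ->.
have s1 : 0 < size p1 < D.
  apply/andP; split; first by rewrite size_rcons.
  by rewrite -sp size_cat -[ltnLHS]addn0 ltn_add2l.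
pose k := D - size p1.
have sk : size p1 + size (take k q) = D.
  by rewrite size_takel ?sq ?leq_subr // subnKC //; case/andP: s1 => _ /ltnW.
have eq : q = take k q ++ drop k q by rewrite cat_take_drop.
rewrite {}eq in hq ne sq.
have [a [b [ab wa wb sa sb]]] := antipodal_walks hp hq ne sp sq s1 sk.
apply: contra ab => zc; apply/eqP; apply: cycle_walk_unique wa wb sa sb.
by rewrite last_rcons.
Qed.

Lemma rev_path_adj x y s : path (@adj G) x s -> last x s = y ->
  path (@adj G) y (rev (belast x s)) /\ last y (rev (belast x s)) = x.
Proof.
move=> ps <-; rewrite path_rev_adj; split=> //.
by case: s {ps} => //= a s; rewrite rev_cons last_rcons.
Qed.

Lemma no_odd_cycle : False.
Proof.
have cyc_neq i j : j < size c -> i < j -> C i != C j.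
  by move=> jm ij; rewrite cyc_eq // !modn_small ?neq_ltn ?ij // (ltn_trans ij).
have n1 : C D.-1 != C (D.-1 + 1) by apply: cyc_neq; move: hD size_c; clear; lia.
have e0 : C (D.-1 + D.-1 + 1) = C 0.
  apply: cyc_mod; first exact: hc.
  have -> : D.-1 + D.-1 + 1 = size c by move: hD size_c; clear; lia.
  by rewrite modnn mod0n.
have n2 : C (D.-1 + D.-1) != C (D.-1 + D.-1 + 1).
  by rewrite e0 eq_sym; apply: cyc_neq; move: hD size_c; clear; lia.
have n3 : C D != C (D + (D - 2)) by apply: cyc_neq; move: hD size_c; clear; lia.
have eD : D.-1 + 1 = D by move: hD; clear; lia.
have e2D : D + (D - 2) = D.-1 + D.-1 by move: hD; clear; lia.
have [g ag gc] := off_cycle_neighbour 0.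
have [mu gmu amu] := repeats_next (cyc_repeats 0 (or_introl erefl)) ag.
have [nu gnu anu] := repeats_next (cyc_repeats 0 (or_intror erefl)) ag.
have [xi muxi axi] := repeats_next (cyc_repeats D.-1 (or_introl erefl)) amu.
rewrite !add0n in amu anu.
have muc : mu \notin c by rewrite -(repeats_in_cycle gmu).
have nuc : nu \notin c by rewrite -(repeats_in_cycle gnu).
have xic : xi \notin c by rewrite -(repeats_in_cycle muxi).
have off1 x : x \notin c -> {in [:: x], forall z, z \notin c}.
  by move=> xc z; rewrite inE => /eqP ->.
(* Here and in the next two claims, equality or adjacency would close a cycle that [cycle_paths_far]
   forbids, of length [D + 1], [3] or [4]. *)
have g_mu : g != mu.
  apply/eqP => e; have n0 : C 0 != C (0 + D.-1).
    by apply: cyc_neq; move: hD size_c; clear; lia.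
  have := @cycle_paths_far 0 D.-1 g mu [::] ag amu isT e (off1 _ gc).
  by rewrite n0 => /(_ isT) /=; move: hD; clear; lia.
have mu_nu : mu != nu.
  apply/eqP => e.
  have := @cycle_paths_far D.-1 1 mu nu [::] amu _ isT e (off1 _ muc).
  by rewrite n1 {1}eD => /(_ anu isT) /=; move: hD; clear; lia.
have mu_nu_adj : ~~ adj mu nu.
  apply/negP => e; have := @cycle_paths_far D.-1 1 mu nu [:: nu] amu.
  rewrite n1 {1}eD /= e => /(_ anu isT erefl) h.
  have /h/(_ isT) : {in [:: mu; nu], forall z, z \notin c}.
    by move=> z; rewrite !inE => /orP[] /eqP ->.
  by move: hD; clear; lia.
have [p [q [pq wp wq lp lq]]] : exists p q,
    [/\ p != q, nbwalk g p mu, nbwalk g q mu, size p <= D & size q <= D].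
  by apply: shortcount_gt1; rewrite -repeats_shortcount.
(* If [p'] were shorter than [D], extending it to the penultimate vertex of [q'] would make that
   vertex a repeat of [g], besides [mu] and [nu]. *)
have full p' q' : p' != q' -> nbwalk g p' mu -> nbwalk g q' mu ->
    size p' <= D -> size q' <= D -> size p' = D.
  move=> ne wp' wq' lp' lq'; apply/eqP; rewrite eqn_leq lp' leqNgt; apply/negP => lt.
  have hh := nbwalk_head_neq ne wp' wq' lp' lq'.
  have hl := nbwalk_last_neq ne wp' wq' lp' lq'.
  case/lastP: q' wq' lq' ne hh hl => [|q' b] wq' lq' ne hh hl.
    by case/and3P: wq' => _ _ /=; rewrite (negPf g_mu).
  have eb : b = mu by case/and3P: wq' => _ _; rewrite last_rcons => /eqP.
  rewrite {}eb in wq' ne lq' hh hl.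
  rewrite belast_rcons last_cons in hl.
  have wq'' : nbwalk g q' (last g q').
    by have [] := @nbwalk_split _ g q' [:: mu] mu; rewrite ?cats1.
  have at_mu : adj (last g q') mu.
    by case/and3P: wq'; rewrite rcons_path => /andP[].
  have wt : nbwalk g (rcons p' (last g q')) (last g q').
    by apply: nbwalk_rcons wp' _ hl; rewrite adj_sym.
  have rt : repeats g (last g q').
    apply: nbwalks_repeats wt wq'' _ _; last by rewrite size_rcons in lq'; apply: ltnW.
      apply: contraNneq hh => e; rewrite -e.
      by case: (p') wp' => [|a u] // /and3P[_ _] /=; rewrite (negPf g_mu).
    by rewrite size_rcons.
  have : size [:: mu; nu; last g q'] <= 2; last by [].
  apply: (@repeats_uniq_le2 g) => [|z]; last by rewrite !inE => /or3P[] /eqP ->.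
  rewrite /= !inE negb_or mu_nu /= andbT; apply/andP; split.
    by apply: contraTneq at_mu => <-; rewrite adj_irrefl.
  by apply: contraNneq mu_nu_adj => ->; rewrite adj_sym.
have sp := full p q pq wp wq lp lq.
have qp : q != p by rewrite eq_sym.
have {full} sq := full q p qp wq wp lq lp.
have pc := antipodal_off_cycle gc muc pq wp wq sp sq.
have qc := antipodal_off_cycle gc muc qp wq wp sq sp.
have ep : p = take 2 p ++ drop 2 p by rewrite cat_take_drop.
have eq : q = take (D - 2) q ++ drop (D - 2) q by rewrite cat_take_drop.
have sp1 : size (take 2 p) = 2 by rewrite size_takel // sp; move: hD; clear; lia.
have sp2 : size (drop 2 p) = D - 2 by rewrite size_drop sp.
have sq1 : size (take (D - 2) q) = D - 2 by rewrite size_takel // sq leq_subr.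
have sq2 : size (drop (D - 2) q) = 2 by rewrite size_drop sq; move: hD; clear; lia.
move: ep eq sp1 sp2 sq1 sq2.
move: (take 2 p) (drop 2 p) (take (D - 2) q) (drop (D - 2) q) => p1 p2 q1 q2.
move=> ep eq sp1 sp2 sq1 sq2; rewrite {}ep {}eq in pq wp wq sp sq pc qc.
(* On the closed walk of length [2 * D], [z] is at position [2] from [g] and [r] is opposite,
   [D - 2] steps from [g] the other way. *)
set z := last g p1; set r := last g q1.
have [s1 [s2 [ne w1 w2 e1 e2]]] : exists s1 s2, [/\ s1 != s2, nbwalk z s1 r,
    nbwalk z s2 r, size s1 = D & size s2 = D].
  by apply: antipodal_walks wp wq pq sp sq _ _; rewrite sp1 ?sq1; move: hD; clear; lia.
have zr : repeats z r by apply: nbwalks_repeats ne w1 w2 _ _; rewrite ?e1 ?e2.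
have [wp1 wp2] := nbwalk_split wp; have [wq1 wq2] := nbwalk_split wq.
case/and3P: wp1 => pp1 _ _; case/and3P: wp2 => pp2 _ /eqP lp2.
case/and3P: wq1 => pq1 _ _; case/and3P: wq2 => pq2 _ /eqP lq2.
have [pp2' lp2'] := rev_path_adj pp2 lp2.
have [pq1' lq1'] := rev_path_adj pq1 erefl.
have [pq2' lq2'] := rev_path_adj pq2 lq2.
have pc1 x : x \in g :: p1 -> x \notin c.
  by move=> h; apply: pc; rewrite -cat_cons mem_cat h.
have pc2 x : x \in z :: p2 -> x \notin c.
  by rewrite inE => /predU1P[->|h]; apply: pc; rewrite -cat_cons mem_cat ?mem_last // h orbT.
have qc1 x : x \in g :: q1 -> x \notin c.
  by move=> h; apply: qc; rewrite -cat_cons mem_cat h.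
have qc2 x : x \in r :: q2 -> x \notin c.
  by rewrite inE => /predU1P[->|h]; apply: qc; rewrite -cat_cons mem_cat ?mem_last // h orbT.
have revc x (s : seq G) : {in x :: s, forall v, v \notin c} ->
    {in rev (belast x s), forall v, v \notin c}.
  by move=> h v; rewrite mem_rev => /mem_belast /h.
have [t1 [pt1 st1 zt1 ht1]] := repeats_path gnu pp1.
have [t2 [pt2 st2 zt2 ht2]] := repeats_path muxi pp2'.
rewrite lp2' in zt2.
have tc1 : {in nu :: t1, forall v, v \notin c}.
  by move=> v /ht1[u hu uv]; rewrite -(repeats_in_cycle uv); apply: pc1.
have tc2 : {in xi :: t2, forall v, v \notin c}.
  move=> v /ht2[u hu uv]; rewrite -(repeats_in_cycle uv).
  by move: hu; rewrite inE => /predU1P[->|/(revc _ _ pc2)].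
rewrite sp1 in st1; rewrite size_rev size_belast sp2 in st2.
have [pt1' lt1'] := rev_path_adj pt1 erefl.
have [pt2' lt2'] := rev_path_adj pt2 erefl.
(* Otherwise [mu] and [nu] are joined by [2 + 2] steps off the cycle, which closes up to length [7],
   below [2 * D]. *)
have far1 : last nu t1 != r.
  apply/eqP => e; rewrite e in pt1' lt1'.
  have := @cycle_paths_far D.-1 1 mu nu (rev (belast r q2) ++ rev (belast nu t1)) amu.
  rewrite {1}eD n1 cat_path last_cat lq2' pq2' pt1' lt1' => /(_ anu isT erefl) h.
  have /h/(_ isT) : {in mu :: rev (belast r q2) ++ rev (belast nu t1), forall v, v \notin c}.
    move=> v; rewrite inE mem_cat => /or3P[/eqP -> //|/(revc _ _ qc2)//|/(revc _ _ tc1)//].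
  rewrite size_cat !size_rev !size_belast sq2 st1; move: hD; clear; lia.
(* Otherwise [xi] and [g] are joined by [2 * (D - 2)] steps, closing up to length [2 * D - 1]. *)
have far2 : last xi t2 != r.
  apply/eqP => e.
  have := @cycle_paths_far (D.-1 + D.-1) 1 xi g (t2 ++ rev (belast g q1)) axi.
  rewrite n2 e0 cat_path last_cat e pt2 lq1' pq1' => /(_ ag isT erefl) h.
  have /h/(_ isT) : {in xi :: t2 ++ rev (belast g q1), forall v, v \notin c}.
    by move=> v; rewrite -cat_cons mem_cat => /orP[/tc2//|/(revc _ _ qc1)].
  rewrite size_cat size_rev size_belast sq1 st2; move: hD; clear; lia.
(* Otherwise [nu] and [xi] are joined by [D] steps, and the arc of length [D - 2] closes up to
   exactly [2 * D]. *)
have far3 : last nu t1 != last xi t2.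
  apply/eqP => e.
  have := @cycle_paths_far D (D - 2) nu xi (t1 ++ rev (belast xi t2)) anu.
  rewrite n3 {1}e2D cat_path last_cat e pt1 lt2' pt2' => /(_ axi isT erefl) h.
  have /h/(_ isT) : {in nu :: t1 ++ rev (belast xi t2), forall v, v \notin c}.
    by move=> v; rewrite -cat_cons mem_cat => /orP[/tc1//|/(revc _ _ tc2)].
  rewrite size_cat size_rev size_belast st1 st2; move: hD; clear; lia.
have : size [:: last nu t1; last xi t2; r] <= 2; last by [].
apply: (@repeats_uniq_le2 z) => [|x]; last by rewrite !inE => /or3P[] /eqP ->.
by rewrite /= !inE negb_or far1 far2 far3.
Qed.

End OddCycle.

(** * The two bounds on the girth *)

Lemma defect2_girth_ge (c : seq G) : graph_cycle c -> 2 * D <= size c.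
Proof.
move=> hc; rewrite leqNgt; apply/negP => lt; have ge := girth_ge hc.
have x0 : G by case: (c) hc => [[]|x].
by apply: (no_odd_cycle x0 hc); apply/eqP; rewrite eqn_leq lt.
Qed.

(** The total excess is positive, so a repeat exists; its two walks glue to a closed
    non-backtracking walk, which contains a cycle. *)
Lemma exists_short_cycle : exists2 c : seq G, graph_cycle c & size c <= 2 * D.
Proof.
(* The diameter is used only to provide a vertex. *)
have [x [_ _]] : exists x y : G, distance_is x y D by case: hG => _ [].
have [y xy] : exists y, repeats x y.
  apply/existsP; apply: contraT; rewrite negb_exists => /forallP nr.
  have := sum_excess x; rewrite big1 // => y _; apply/eqP.
  by have := nr y; rewrite /repeats lt0n negbK.
rewrite repeats_shortcount in xy.
have [s1 [s2 [ne w1 w2 l1 l2]]] := shortcount_gt1 xy.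
have w := nbwalk_glue w1 w2 (nbwalk_head_neq ne w1 w2 l1 l2).
have [|c hc cs] := nbwalk_cycle w.
  have : rev (belast x s1) ++ s2 != [::].
    apply: contraNneq ne => /(congr1 size)/eqP.
    by rewrite size_cat size_rev size_belast addn_eq0 => /andP[/nilP -> /nilP ->].
  case/and3P: w => _ _; case/lastP: (_ ++ _) => // s z.
  by rewrite last_rcons => /eqP -> _; rewrite /= mem_rcons mem_head.
exists c => //; apply: leq_trans cs _.
by rewrite size_cat size_rev size_belast mul2n -addnn leq_add.
Qed.

End Repeats.

Theorem theorem5p2 (d D : nat) (hd : 4 <= d) (hD : 4 <= D) (G : sgraph)
  (hG : defect_graph d D 2 G) : girth_is G (2 * D).
Proof.
have ge := defect2_girth_ge hd hD hG; split=> //.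
have [c hc le] := exists_short_cycle hd hD hG.
by exists c => //; apply/eqP; rewrite eqn_leq le ge.
Qed.
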